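(* Let $\boldsymbol\theta=\langle(\varepsilon_n,\bar a_n)\rangle_{n\in\mathbb Z}\in\Sigma^{\mathbb Z}$. For $n\in\mathbb Z$, the map $$\phi_n:W_n\to\overline{\mathbb D},\qquad\phi_n(z)=e^{-2\pi iz/l_{[n-1]}}$$ satisfies the following properties. (1) $\phi_n$ conformally sends the interior of $W_n$ onto the open unit disk $\mathbb D$ minus the radial slit $\{\arg z=-2\pi\theta_n\}$ (the slit being understood to include $0$), and sends each of the two vertical sides of $W_n$ to this slit. (2) $\phi_n$ projects the commuting pair $\mathcal F_n$ to the rotation $\mathbf R_{\theta_n}:\overline{\mathbb D}\to\overline{\mathbb D}$; that is, $\phi_n\circ F^{Q_{[n]}}=\mathbf R_{\theta_n}\circ\phi_n$ on $W'_{n,0}$ and $\phi_n\circ F^{Q_{[n]}-\varepsilon_n\varepsilon_{n+1}Q_{[n-1]}}=\mathbf R_{\theta_n}\circ\phi_n$ on $W'_{n,1}$. (3) For $k\ge n+1$, $\phi_n$ maps $W_k$ conformally onto the sector $S_{\theta_n}^{k-n}$ (with its vertex $0$ removed), and the commuting pair $\mathcal F_k$ projects under $\phi_n$ to the first return map of $\mathbf R_{\theta_n}$ back to the sector $S_{\theta_n}^{k-n}$ (at points $\phi_n(z)$ with $\mathrm{Re}\,z$ in the interior of $J'_{k,0}$ or $J'_{k,1}$).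
   Context: $\Sigma=\{-1,+1\}\times\mathbb N_{\ge2}$; $\mathbf R_\vartheta(z)=e^{2\pi i\vartheta}z$ on the closed unit disk $\overline{\mathbb D}$. For $\boldsymbol\theta=\langle(\varepsilon_n,\bar a_n)\rangle_{n\in\mathbb Z}\in\Sigma^{\mathbb Z}$ put $b_n=\bar a_n+\frac{1+\varepsilon_n\varepsilon_{n+1}}2$ and, for $n\in\mathbb Z$, $\theta_n=\cfrac{1}{\varepsilon_{n+1}b_{n+1}-\cfrac{1}{\varepsilon_{n+2}b_{n+2}-\cdots}}\in(-\tfrac12,\tfrac12)\setminus\mathbb Q$ (limit of finite truncations). Let $l_{[n]}=|\theta_0\cdots\theta_n|$ for $n\ge0$, $l_{[-1]}=1$, $l_{[n]}=|\theta_{-1}\theta_{-2}\cdots\theta_{n+1}|^{-1}$ for $n\le-2$. The time group $\mathbf T^{\mathrm{gp}}$ is the additive abelian group generated by $\{Q_{[n]}\}_{n\in\mathbb Z}$ subject to $Q_{[n+1]}=b_{n+1}Q_{[n]}-\varepsilon_n\varepsilon_{n+1}Q_{[n-1]}$ for all $n$. Each $P\in\mathbf T^{\mathrm{gp}}$ acts by a translation $F^P$ of $\mathbb C$, where $P\mapsto F^P$ is the group homomorphism with $F^{Q_{[n]}}(z)=z-\varepsilon_{n+1}l_{[n]}$. Put $V_P=F^P(0)$. For real $x,y$, $[x,y]$ is the closed interval with endpoints $x,y$ (in either order). Let $J_{n,0}=[V_{-Q_{[n]}+\varepsilon_n\varepsilon_{n+1}Q_{[n-1]}},0]$, $J_{n,1}=[0,V_{-Q_{[n]}}]$,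 $J_n=J_{n,0}\cup J_{n,1}=[V_{-Q_{[n]}},V_{-Q_{[n]}+\varepsilon_n\varepsilon_{n+1}Q_{[n-1]}}]$, and $J'_{n,j}=F^{-Q_{[n]}+j\varepsilon_n\varepsilon_{n+1}Q_{[n-1]}}(J_{n,j})$ for $j\in\{0,1\}$ (so $J_n=J'_{n,0}\cup J'_{n,1}$). For a closed interval $J\subset\mathbb R$, $W(J)=\{z\in\mathbb C:\mathrm{Im}\,z\le0,\ \mathrm{Re}\,z\in J\}$; $W_n=W(J_n)$, $W_{n,j}=W(J_{n,j})$, $W'_{n,j}=W(J'_{n,j})$. The commuting pair is $\mathcal F_n=(F^{Q_{[n]}}:W'_{n,0}\to W_{n,0},\ F^{Q_{[n]}-\varepsilon_n\varepsilon_{n+1}Q_{[n-1]}}:W'_{n,1}\to W_{n,1})$. Sectors: for $m\in\mathbb Z$, with $\bar a=\lfloor1/|\theta_m|\rfloor$, $S^1_{\theta_m}$ is the closed sector of $\overline{\mathbb D}$ bounded by the radial segments from $0$ to $\mathbf R_{\theta_m}^{-\bar a-1}(1)$ and from $0$ to $\mathbf R_{\theta_m}^{-\bar a}(1)$ and the shortest circular arc joining these endpoints (it contains $1$); $\psi_{\theta_m}:S^1_{\theta_m}\to\overline{\mathbb D}$, $\psi_{\theta_m}(z)=z^{1/|\theta_m|}$ (branch fixing $1$); and $S^{r}_{\theta_m}:=\psi_{\theta_m}^{-1}(S^{r-1}_{\theta_{m+1}})$ for $r\ge2$. *)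

(* Defs.v *)
From HB Require Import structures.
From mathcomp Require Import all_boot all_order all_algebra.
From mathcomp Require Import generic_quotient ring_quotient.
From mathcomp Require Import all_classical all_reals all_analysis.
From mathcomp.real_closed Require Import complex.
From mathcomp.multinomials Require Import freeg.
From mathcomp Require Import lra ring zify.

Set Implicit Arguments.
Unset Strict Implicit.
Unset Printing Implicit Defensive.

Import Order.TTheory GRing.Theory Num.Theory.
Import numFieldNormedType.Exports.

Local Open Scope classical_set_scope.
Local Open Scope ring_scope.

Definition Sigma := {x : int * nat | ((x.1 == -1) || (x.1 == 1)) && (2 <= x.2)%N}.

Section Sequence.
Variable s : int -> Sigma.

Definition eps (n : int) : int := (val (s n)).1.
Definition abar (n : int) : nat := (val (s n)).2.

(* The division by 2 is exact, since eps n * eps (n + 1) is -1 or 1. *)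
Definition bcoef (n : int) : int := (abar n)%:Z + ((1 + eps n * eps (n + 1)) %/ 2)%Z.

Lemma epsP n : eps n = -1 \/ eps n = 1.
Proof. by rewrite /eps; case: (s n) => [[e a]] /= /andP[/orP[]/eqP -> _]; [left|right]. Qed.

Lemma abar_ge2 n : (2 <= abar n)%N.
Proof. by rewrite /abar; case: (s n) => [[e a]] /= /andP[]. Qed.

Definition timeRel (n : int) : {freeg int} :=
  << n + 1 >> - (<< n >> *~ bcoef (n + 1) - << n - 1 >> *~ (eps n * eps (n + 1))).

(* The smallest subgroup of the free abelian group that contains every [timeRel n]. *)
Definition relSub : {pred {freeg int}} :=
  fun D => `[< forall S : {pred {freeg int}},
                 zmod_closed S -> (forall n, timeRel n \in S) -> D \in S >].

Lemma relSub_zmod_closed : zmod_closed relSub.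
Proof.
split=> [|x y]; first by apply/asboolP => S [].
move=> /asboolP Sx /asboolP Sy; apply/asboolP => S Scl Srel.
by apply: Scl.2; [exact: Sx|exact: Sy].
Qed.

HB.instance Definition _ :=
  GRing.isZmodClosed.Build {freeg int} relSub relSub_zmod_closed.

Definition TimeGroup := Quotient.quot relSub.
HB.instance Definition _ := GRing.Zmodule.on TimeGroup.

Definition Q (n : int) : TimeGroup := (\pi_(TimeGroup) << n >>)%qT.

Lemma Q_rel n : Q (n + 1) = Q n *~ bcoef (n + 1) - Q (n - 1) *~ (eps n * eps (n + 1)).
Proof.
rewrite /Q -!raddfMz -raddfB; apply/eqP; rewrite -Quotient.idealrBE.
by apply/asboolP => S _; apply.
Qed.

End Sequence.

Section ContinuedFraction.
Variables (R : realType) (s : int -> Sigma).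

Fixpoint thetaTrunc (N : nat) (n : int) : R :=
  if N is N'.+1 then
    ((eps s (n + 1) * bcoef s (n + 1))%:~R - thetaTrunc N' (n + 1))^-1
  else 0.

Definition theta (n : int) : R := limn (fun N => thetaTrunc N n).

Definition len (n : int) : R :=
  match n with
  | Posz k => \prod_(i < k.+1) `|theta (Posz i)|
  | Negz k => (\prod_(i < k) `|theta (Negz i)|)^-1
  end.

Local Notation e n := ((eps s n)%:~R : R).

Lemma epsRP n : e n = -1 \/ e n = 1.
Proof. by case: (epsP s n) => ->; [left|right]. Qed.

Lemma bR n : (bcoef s n)%:~R = (abar s n)%:R + (1 + e n * e (n + 1)) / 2 :> R.
Proof.
rewrite /bcoef rmorphD /=; congr (_ + _).
case: (epsP s n) => ->; case: (epsP s (n + 1)) => ->; set z := (_ %/ 2)%Z.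
- have -> : z = 1 by []; by rewrite !rmorphN /=; field.
- have -> : z = 0 by []; by rewrite !rmorphN /=; field.
- have -> : z = 0 by []; by rewrite !rmorphN /=; field.
- have -> : z = 1 by []; by rewrite /=; field.
Qed.

Lemma den_ge2 n (x : R) : `|x| <= 1/2 -> 0 <= e (n + 1) * x ->
  2 <= e n * ((eps s n * bcoef s n)%:~R - x).
Proof.
rewrite ler_norml => /andP[x1 x2] x0; rewrite rmorphM /= bR.
have a2 : 2 <= (abar s n)%:R :> R by rewrite ler_nat abar_ge2.
by move: x0; case: (epsRP n) => ->; case: (epsRP (n + 1)) => -> x0; nra.
Qed.

Lemma inv_bound n (y : R) : 2 <= e n * y ->
  [/\ y != 0, 2 <= `|y|, `|y^-1| <= 1/2 & 0 <= e n * y^-1].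
Proof.
move=> y2.
have ne : `|e n| = 1 by case: (epsRP n) => ->; rewrite ?normrN normr1.
have y2' : 2 <= `|y| by have := le_trans y2 (ler_norm _); rewrite normrM ne mul1r.
have y0 : y != 0 by rewrite -normr_gt0; lra.
split => //.
  by rewrite normfV mul1r lef_pV2 // posrE; lra.
have -> : e n * y^-1 = (e n * y) * (y^-1) ^+ 2 by field.
by rewrite mulr_ge0 ?sqr_ge0//; lra.
Qed.

Lemma thetaTrunc_bound N n :
  `|thetaTrunc N n| <= 1/2 /\ 0 <= e (n + 1) * thetaTrunc N n.
Proof.
elim: N n => [|N IH] n /=; first by rewrite normr0 mulr0; lra.
have [h1 h2] := IH (n + 1).
by have [] := inv_bound (den_ge2 h1 h2).
Qed.

Lemma thetaTrunc_step N n :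
  `|thetaTrunc N.+1 n - thetaTrunc N n| <= (1/2) * (1/4) ^+ N.
Proof.
elim: N n => [|N IH] n.
  by rewrite expr0 mulr1 [thetaTrunc 0 n]/= subr0; apply: (thetaTrunc_bound 1 n).1.
have [h1 h2] := thetaTrunc_bound N.+1 (n + 1).
have [k1 k2] := thetaTrunc_bound N (n + 1).
have [u0 u2 _ _] := inv_bound (den_ge2 h1 h2).
have [v0 v2 _ _] := inv_bound (den_ge2 k1 k2).
have := IH (n + 1).
have tS M : thetaTrunc M.+1 n =
    ((eps s (n + 1) * bcoef s (n + 1))%:~R - thetaTrunc M (n + 1))^-1 by [].
rewrite (tS N.+1) (tS N); move: u0 u2 v0 v2.
set c := _%:~R.
set x := thetaTrunc N.+1 (n + 1).
set y := thetaTrunc N (n + 1).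
move=> u0 u2 v0 v2 xy.
have -> : (c - x)^-1 - (c - y)^-1 = (x - y) * (c - x)^-1 * (c - y)^-1.
  by move: u0 v0; clearbody c x y => u0 v0; field; rewrite v0.
have q : `|(c - x)^-1| * `|(c - y)^-1| <= 1/4.
  rewrite !normfV.
  have a1 : `|c - x|^-1 <= 1/2 by rewrite mul1r lef_pV2 ?posrE; lra.
  have a2 : `|c - y|^-1 <= 1/2 by rewrite mul1r lef_pV2 ?posrE; lra.
  have -> : 1/4 = (1/2) * (1/2) :> R by field.
  by rewrite ler_pM// invr_ge0.
rewrite !normrM -[leLHS]mulrA exprSr [leRHS]mulrA.
by apply: ler_pM xy q => //; exact: mulr_ge0.
Qed.

Lemma thetaTrunc_cvg n : cvgn (fun N => thetaTrunc N n).
Proof.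
pose u k := thetaTrunc k.+1 n - thetaTrunc k n.
have -> : (fun N => thetaTrunc N n) = series u.
  apply/funext => N; rewrite /series /= /u.
  by rewrite telescope_sumr// subr0.
apply: normed_cvg; apply: (@series_le_cvg _ _ (geometric (1/2) (1/4))) => [k|k|k|].
- exact: normr_ge0.
- by rewrite /= mulr_ge0// ?exprn_ge0//; lra.
- exact: thetaTrunc_step.
- by apply: is_cvg_geometric_series; rewrite ger0_norm; lra.
Qed.

Lemma theta_bound n : `|theta n| <= 1/2 /\ 0 <= e (n + 1) * theta n.
Proof.
have cv := @thetaTrunc_cvg n; split.
  rewrite /theta -lim_norm//; apply: limr_le; first exact: is_cvg_norm.
  by near=> N; exact: (thetaTrunc_bound N n).1.
have -> : e (n + 1) * theta n = limn (fun N => e (n + 1) * thetaTrunc N n).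
  by apply/esym/cvg_lim => //; apply: cvgM; [exact: cvg_cst|exact: cv].
apply: limr_ge; first by apply: is_cvgM => //; exact: is_cvg_cst.
by near=> N; exact: (thetaTrunc_bound N n).2.
Unshelve. all: by end_near. Qed.

Lemma theta_rec n :
  (eps s (n + 1) * bcoef s (n + 1))%:~R - theta (n + 1) != 0 /\
  theta n = ((eps s (n + 1) * bcoef s (n + 1))%:~R - theta (n + 1))^-1.
Proof.
have [h1 h2] := theta_bound (n + 1).
have [d0 _ _ _] := inv_bound (den_ge2 h1 h2).
split=> //; apply/cvg_lim => //.
rewrite -(@cvg_shiftS _ _) /=.
apply: cvgV => //; apply: cvgB; first exact: cvg_cst.
exact: (@thetaTrunc_cvg (n + 1)).
Qed.

Lemma theta_neq0 n : theta n != 0.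
Proof. by have [d0 ->] := theta_rec n; rewrite invr_eq0. Qed.

Lemma theta_norm n : `|theta n| = e (n + 1) * theta n.
Proof.
have [_] := theta_bound n; have := theta_neq0 n.
case: (epsRP (n + 1)) => -> t0; rewrite ?mulN1r ?mul1r => h.
  by rewrite ler0_norm// -oppr_ge0.
by rewrite ger0_norm.
Qed.

Lemma len_rec n : len n = `|theta n| * len (n - 1).
Proof.
case: n => [[|k]|k].
- by rewrite /len /= big_ord1 big_ord0 invr1 mulr1.
- have -> : Posz k.+1 - 1 = Posz k by rewrite -addn1 PoszD addrK.
  by rewrite /len big_ord_recr /= mulrC.
- have -> : Negz k - 1 = Negz k.+1 by rewrite !NegzE; lia.
  rewrite /len big_ord_recr /= invfM mulrC mulfVK//.
  by rewrite normr_eq0 theta_neq0.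
Qed.

(* Translation lengths, on the free abelian group. *)
Definition preTransl : {freeg int} -> R :=
  fglift (fun n : int => - e (n + 1) * len n : zmodule R).

Lemma preTransl_is_additive : zmod_morphism preTransl.
Proof. exact: (@lift_is_additive int int (zmodule R)). Qed.

HB.instance Definition _ :=
  GRing.isZmodMorphism.Build {freeg int} R preTransl preTransl_is_additive.

Lemma preTranslU n : preTransl << n >> = - e (n + 1) * len n.
Proof. by rewrite /preTransl liftU scale1r. Qed.

Lemma preTransl_rel n : preTransl (timeRel s n) = 0.
Proof.
have pB x y : preTransl (x - y) = preTransl x - preTransl y by exact: raddfB.
have pM x k : preTransl (x *~ k) = k%:~R * preTransl x by rewrite raddfMz mulrzl.
rewrite /timeRel !pB !pM !preTranslU (subrK 1 n) rmorphM /=.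
have [d0 Dn] := theta_rec n.
have := len_rec (n + 1); rewrite addrK theta_norm => ->.
have := len_rec n; rewrite theta_norm {}Dn rmorphM /= => l.
have {l} : (e (n + 1) * (bcoef s (n + 1))%:~R - theta (n + 1)) * len n
           = e (n + 1) * len (n - 1).
  rewrite {}l; move: d0; rewrite rmorphM /=.
  by move: (_ - theta (n + 1)) => d d0; rewrite -mulrA mulrCA mulVKf.
have e1 : e (n + 1) * e (n + 1) = 1 by case: (epsRP (n + 1)) => ->; ring.
have e2 : e (n + 1 + 1) * e (n + 1 + 1) = 1 by case: (epsRP (n + 1 + 1)) => ->; ring.
have e0 : e n * e n = 1 by case: (epsRP n) => ->; ring.
move=> l.
transitivity ((e (n + 1) * (bcoef s (n + 1))%:~R - (e (n + 1 + 1) * e (n + 1 + 1)) * theta (n + 1)) * len n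
   - (e n * e n) * e (n + 1) * len (n - 1)); last first.
  by rewrite e0 e2 !mul1r l subrr.
by ring.
Qed.

Definition transl (P : TimeGroup s) : R := preTransl (repr P)%qT.

(* [transl] does not depend on the representative chosen by [repr]. *)
Lemma transl_pi (D : {freeg int}) : transl (\pi_(TimeGroup s) D)%qT = preTransl D.
Proof.
rewrite /transl; apply/eqP; rewrite -subr_eq0 -raddfB.
have : repr (\pi_(TimeGroup s) D)%qT - D \in relSub s.
  by rewrite Quotient.idealrBE reprK.
move=> /asboolP /(_ [pred D | preTransl D == 0]); apply => [|n].
  split=> [|x y]; rewrite !inE ?raddf0// => /eqP x0 /eqP y0.
  by rewrite raddfB /= x0 y0 subrr.
by rewrite inE preTransl_rel.
Qed.

Lemma transl_is_additive : zmod_morphism transl.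
Proof.
move=> P P'; rewrite -[P]reprK -[P']reprK -raddfB !transl_pi.
exact: raddfB.
Qed.

HB.instance Definition _ :=
  GRing.isZmodMorphism.Build (TimeGroup s) R transl transl_is_additive.

Lemma transl_Q n : transl (Q s n) = - e (n + 1) * len n.
Proof. by rewrite transl_pi preTranslU. Qed.

End ContinuedFraction.

Local Open Scope complex_scope.

Section Plane.
Variables (R : realType) (s : int -> Sigma).
(* The regular module R[i]^o carries the topology of the complex plane;
   derivability in direction 1 over the field R[i] is complex differentiability. *)
Local Notation C := (R[i]^o).
Local Notation Re := complex.Re.
Local Notation Im := complex.Im.

Definition F (P : TimeGroup s) (z : C) : C := z + (transl R P)%:C.

Lemma F_add P P' : F (P + P') = F P \o F P'.
Proof.
by apply/funext => z; rewrite /F /= raddfD rmorphD /= addrAC addrA.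
Qed.

Lemma F_Q n z : F (Q s n) z = z - ((eps s (n + 1))%:~R * len R s n)%:C.
Proof. by rewrite /F transl_Q mulNr rmorphN. Qed.

Definition V (P : TimeGroup s) : C := F P 0.

Definition seg (x y : R) : set R := [set` `[Num.min x y, Num.max x y]].

(* The index j in {0, 1} is a boolean; [retTime n j] is the exponent
   Q_[n] - j eps_n eps_(n+1) Q_[n-1] of the j-th map of the commuting pair. *)
Definition retTime (n : int) (j : bool) : TimeGroup s :=
  Q s n - Q s (n - 1) *~ (eps s n * eps s (n + 1) *+ j).

(* The translations are real, so that Re (V P) is V P and the real line is
   invariant under F P. *)
Definition Jj (n : int) (j : bool) : set R :=
  if j then seg 0 (Re (V (- retTime n false)))
  else seg (Re (V (- retTime n true))) 0.

Definition J (n : int) : set R := Jj n false `|` Jj n true.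

Definition Jj' (n : int) (j : bool) : set R :=
  [set Re (F (- retTime n j) x%:C) | x in Jj n j].

Definition halfStrip (I : set R) : set C := [set z | Im z <= 0 /\ I (Re z)].

Definition W (n : int) : set C := halfStrip (J n).
Definition Wj (n : int) (j : bool) : set C := halfStrip (Jj n j).
Definition Wj' (n : int) (j : bool) : set C := halfStrip (Jj' n j).

Definition verticalSide (n : int) (j : bool) : set C :=
  halfStrip [set Re (V (- retTime n j))].

Definition cexp (z : C) : C :=
  ((expR (Re z))%:C : C) * (cos (Im z) +i* sin (Im z)).

(* The principal argument, in ]-pi, pi]; a junk value at 0. *)
Definition carg (z : C) : R :=
  let t := acos (Re z / Normc.normc z) in if 0 <= Im z then t else - t.

Definition rotation (t : R) (z : C) : C := cexp ((2 * pi * t) *i) * z.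

Definition closedDisk : set C := [set z | `|z| <= 1].
Definition openDisk : set C := [set z | `|z| < 1].

Definition phi (n : int) (z : C) : C :=
  cexp (- (((2 * pi) *i : C) * z / (len R s (n - 1))%:C)).

(* Since |theta n| < 1/2, the principal argument is the right one here. *)
Definition slit (n : int) : set C :=
  [set z | closedDisk z /\ (z = 0 \/ carg z = - (2 * pi * theta R s n))].

Definition circlePt (t : R) : C := rotation t 1.

(* Lifts x, y of the two angles at distance less than half a turn determine the
   shortest arc. *)
Definition shortestArc (p q : C) : set C :=
  [set w | exists x y u : R, [/\ p = circlePt x, q = circlePt y,
     `|x - y| < 1/2, seg x y u & w = circlePt u]].

Definition sector (p q : C) : set C :=
  [set z | exists r w, [/\ 0 <= r <= 1, shortestArc p q w & z = (r%:C : C) * w]].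

(* The k-th iterate of [rotation t] is [rotation (k t)]. *)
Definition sector1 (t : R) : set C :=
  let a := Num.floor (1 / `|t|) in
  sector (rotation ((- a - 1)%:~R * t) 1) (rotation ((- a)%:~R * t) 1).

(* The principal branch of z^(1/|t|), with value 0 at 0. *)
Definition psi (t : R) (z : C) : C :=
  (((Normc.normc z) `^ (1 / `|t|))%:C : C) * cexp ((carg z / `|t|) *i).

(* Meaningful for r >= 1 only. *)
Fixpoint sectorS (r : nat) (m : int) : set C :=
  match r with
  | 0 => setT
  | 1 => sector1 (theta R s m)
  | r'.+1 => sector1 (theta R s m) `&` psi (theta R s m) @^-1` sectorS r' (m + 1)
  end.

(* On a set A that is not open, "conformal" means conformal on a neighbourhood
   of A. *)
Definition conformal_onto (f : C -> C) (A B : set C) : Prop :=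
  exists U : set C, [/\ open U, A `<=` U, set_inj U f,
    forall z, U z -> derivable f z 1 /\ 'D_1 f z != 0 & f @` A = B].

Definition first_return (f : C -> C) (S : set C) (x y : C) : Prop :=
  S x /\ exists N : nat, [/\ (0 < N)%N, iter N f x = y, S y &
    forall k : nat, (0 < k < N)%N -> ~ S (iter k f x)].

End Plane.

Arguments closedDisk R : clear implicits.
Arguments openDisk R : clear implicits.
Arguments Jj R s : clear implicits.
Arguments Jj' R s : clear implicits.
Arguments J R s : clear implicits.
Arguments W R s : clear implicits.
Arguments Wj R s : clear implicits.
Arguments Wj' R s : clear implicits.
Arguments verticalSide R s : clear implicits.
Arguments slit R s : clear implicits.
Arguments phi R s : clear implicits.
Arguments sectorS R s : clear implicits.

(* Main.v *)
Require Import Defs.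
From HB Require Import structures.
From mathcomp Require Import all_boot all_order all_algebra.
From mathcomp Require Import all_classical all_reals all_analysis.
From mathcomp.real_closed Require Import complex.
From mathcomp Require Import lra ring zify.
Import Order.TTheory GRing.Theory Num.Theory numFieldNormedType.Exports.
Local Open Scope classical_set_scope.
Local Open Scope ring_scope.
Local Open Scope complex_scope.

Set Implicit Arguments.
Unset Strict Implicit.
Unset Printing Implicit Defensive.

Local Notation Re := complex.Re.
Local Notation Im := complex.Im.

(** Write l_k for [len R s k] and e_k for [eps s k].  The map phi_n is the
    exponential z |-> exp (- 2 pi i z / l_(n-1)), which is injective on vertical
    strips of width l_(n-1), has period l_(n-1), and turns the translation by a
    real x into the rotation by - x / l_(n-1) turns.  The interval J_n is
    e_(n+1) [l_n - l_(n-1), l_n], of length exactly l_(n-1): phi_n wraps the half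
    strip W_n once around the punctured disk and glues its two vertical sides
    along the ray of angle - 2 pi e_(n+1) l_n / l_(n-1) = - 2 pi theta_n.  As
    Q_[n] translates by - e_(n+1) l_n and Q_[n-1] by a period of phi_n, every
    m Q_[n] + p Q_[n-1] becomes the rotation by m theta_n ([phi_F_lattice]);
    both maps of the pair have m = 1.

    Sectors.  The relation of the time group, read on lengths, is
    l_(n-1) = (abar_(n+1) + (1 + e e') / 2) l_n - e e' l_(n+1) with e = e_(n+1)
    and e' = e_(n+2) ([len_three_term]).  It says that the two radii that bound the
    first sector of theta_n are the images of the endpoints of J_(n+1)
    ([sector1_phi]).  On W_(n+1) the principal argument of phi_n is given by the
    exponent, so psi_(theta_n) o phi_n = phi_(n+1) there ([psi_phi]), and the
    deeper sectors follow by induction ([sectorS_phi]).  The one danger is that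
    psi_(theta_n) sends both sides of the first sector to the same slit, which would
    add a spurious radius to a preimage; it does not occur because J_(k+1) lies
    in the interior of J_k ([J_strictly_nested]).

    First returns.  Passing from level k to level k + 1 replaces the pair of
    times (A_0, A_1) by (q_0 A_0 + A_1, q_1 A_0 + A_1), with q_0, q_1 > 0 and
    q_0 - q_1 = e e' ([retTime_succ]).  Hence, starting from level n, the
    coefficients N_j of Q_[n] in the times of level k are positive, and the two
    times form a basis of the lattice spanned by Q_[n] and Q_[n-1]
    ([renormalization]).  A visit of the rotation orbit of phi_n z to the sector
    at time m, with 0 < m < N_j, would be a lattice element c_0 A_0 + c_1 A_1
    that maps Re z into J_k and has m = c_0 N_0 + c_1 N_1.  But A_0 and A_1 move
    points in opposite directions, by l_k and l_(k-1) - l_k, which add up to the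
    length of J_k: c_0 and c_1 cannot have opposite signs, m < N_j forces
    c_j = 0, and then the other map alone pushes Re z out of J_k
    ([no_early_return]). *)

(** * The complex exponential *)

(** An inequality in place of the limit of the difference quotient: for a complex
    function it splits into bounds on the real and the imaginary part. *)
Lemma is_derive_from_remainder (K : numFieldType) (V W : normedModType K)
    (f : V -> W) (a v : V) (d : W) :
  (forall eps : K, 0 < eps -> exists2 del : K, 0 < del &
     forall h : K, `|h| < del -> `|f (h *: v + a) - f a - h *: d| <= eps * `|h|) ->
  is_derive a v f d.
Proof.
move=> H.
have C : (fun h => h^-1 *: ((f \o shift a) (h *: v) - f a)) @ 0^' --> d.
  apply/cvgrPdist_le => eps eps0; have [del del0 D] := H _ eps0.
  rewrite near_withinE; apply/nbhs_ballP; exists del => //= h.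
  rewrite /ball /= sub0r normrN => hd h0.
  have -> : d - h^-1 *: (f (h *: v + a) - f a) =
            - (h^-1 *: (f (h *: v + a) - f a - h *: d)).
    by rewrite [in RHS]scalerBr scalerK// opprB.
  rewrite normrN normrZ normfV mulrC ler_pdivrMr ?normr_gt0//.
  exact: D.
by split; [apply/cvg_ex; exists d | exact: cvg_lim].
Qed.

Section ComplexExponential.
Variable R : realType.
Implicit Types (x y t : R) (z w : R[i]^o).

Lemma complexP z w : Re z = Re w -> Im z = Im w -> z = w.
Proof. by case: z w => a b [c d] /= -> ->. Qed.

Lemma shift_into_period (a l t : R) : 0 < l ->
  exists m : int, a <= t + l * m%:~R < a + l.
Proof.
move=> l0; exists (- Num.floor ((t - a) / l)).
have := floor_itv ((t - a) / l); rewrite rmorphN rmorphD /=.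
move: (_%:~R) => r; rewrite ler_pdivlMr// ltr_pdivrMr// => /andP[h1 h2].
by apply/andP; split; lra.
Qed.

Lemma cosD2pi_int t (m : int) : cos (t + 2 * pi * m%:~R) = cos t.
Proof.
have P k u : cos (u + 2 * pi * k%:R) = cos u :> R.
  by rewrite -[RHS](periodicn (@cosD2pi R) k); congr cos; rewrite -mulr_natr; ring.
case: (intP m) => [|k|k]; rewrite ?mulr0 ?addr0 ?P //.
rewrite -[LHS](P k.+1); congr cos; rewrite mulrNz pmulrn; ring.
Qed.

Lemma sinD2pi_int t (m : int) : sin (t + 2 * pi * m%:~R) = sin t.
Proof.
have E u : sin u = cos (u - pi / 2) :> R by rewrite cosBpihalf.
by rewrite E addrAC cosD2pi_int -E.
Qed.

(** Moving t into [- pi, pi[ leaves an interval on which cos is injective up to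
    sign. *)
Lemma cos_eq1 t : cos t = 1 -> exists m : int, t = 2 * pi * m%:~R.
Proof.
move=> ct; have pp := pi_gt0 R.
have l0 : 0 < 2 * pi :> R by lra.
have [m /andP[]] := shift_into_period (- pi) t l0.
have := cosD2pi_int t m; rewrite ct; set u := t + _ => cu u1 u2.
suff u0 : u = 0 by exists (- m); rewrite rmorphN /=; move: u0; rewrite /u; lra.
have [up|un] := leP 0 u.
  by apply: (@cos_inj R); rewrite ?in_itv /= ?cos0// ?lexx ?up/=; lra.
suff : - u = 0 by lra.
by apply: (@cos_inj R); rewrite ?in_itv /= ?cosN ?cos0//; apply/andP; split; lra.
Qed.

Lemma cexpD z w : cexp (z + w) = cexp z * cexp w.
Proof.
case: z w => a b [c d]; rewrite /cexp /= expRD cosD sinD.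
by apply: complexP; simpc => /=; ring.
Qed.

Lemma cexp0 : cexp (0 : R[i]^o) = 1.
Proof. by apply: complexP; rewrite /cexp /= expR0 cos0 sin0; ring. Qed.

Lemma cexp_neq0 z : cexp z != 0.
Proof.
apply/eqP => z0; have := cexpD z (- z).
by rewrite subrr cexp0 z0 mul0r => /eqP; rewrite oner_eq0.
Qed.

Lemma normc_cexp z : Normc.normc (cexp z) = expR (Re z).
Proof.
rewrite /cexp Normc.normcM /= expr0n addr0 cos2Dsin2 sqrtr1 mulr1.
by rewrite sqrtr_sqr ger0_norm ?expR_ge0.
Qed.

(** The modulus of [cexp z] determines the real part of z, and [cos_eq1] applies to
    the imaginary part of z - w. *)
Lemma cexp_eq z w : cexp z = cexp w ->
  Re z = Re w /\ exists m : int, Im z = Im w + 2 * pi * m%:~R.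
Proof.
move=> zw; have zw1 : cexp (z - w) = 1.
  apply: (mulIf (cexp_neq0 w)); by rewrite -cexpD subrK mul1r.
have r0 : Re (z - w) = 0.
  by apply: expR_inj; rewrite expR0 -normc_cexp zw1 Normc.normc1.
have : cos (Im (z - w)) = 1.
  by have := congr1 (fun u : R[i]^o => Re u) zw1; rewrite /cexp r0 expR0 /=; lra.
move=> /cos_eq1[m]; rewrite !raddfB /= in r0 * => im.
by split; [lra | exists m; lra].
Qed.

(** The principal argument is an acos whose sign is that of the imaginary part,
    which is the sign of sin on ]- pi, pi]. *)
Lemma carg_cexp z : - pi < Im z <= pi -> carg (cexp z) = Im z.
Proof.
move=> /andP[h1 h2]; rewrite /carg normc_cexp.
have -> : Re (cexp z) / expR (Re z) = cos (Im z).
  by rewrite /cexp /= mul0r subr0 mulrAC divff ?mul1r// gt_eqF ?expR_gt0.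
have -> : Im (cexp z) = expR (Re z) * sin (Im z) by rewrite /cexp /= mul0r addr0.
rewrite pmulr_rge0 ?expR_gt0//.
have [p|p] := leP 0 (Im z).
  by rewrite sin_ge0_pi ?p// cosK// in_itv /= p.
have : 0 < sin (- Im z) by apply: sin_gt0_pi; apply/andP; split; lra.
rewrite sinN oppr_gt0 ltNge => /negbTE ->.
rewrite cosKN ?opprK//; apply/andP; split; lra.
Qed.

(** Polar coordinates; the half-open window of angles makes z unique. *)
Lemma cexp_surj w (a : R) : w != 0 ->
  exists z : R[i]^o, [/\ cexp z = w, a <= Im z & Im z < a + 2 * pi].
Proof.
move=> w0; have pp := pi_gt0 R.
have l0 : 0 < 2 * pi :> R by lra.
set r := Normc.normc w.
have r0 : 0 < r.
  rewrite lt_def /r; case: (w) w0 => u v w0 /=; rewrite sqrtr_ge0 andbT.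
  by apply: contraNneq w0 => /(@Normc.eq0_normc _ (u +i* v)) ->.
have rr : Re w ^+ 2 + Im w ^+ 2 = r ^+ 2.
  rewrite /r; case: (w) => u v /=; rewrite sqr_sqrtr//.
  by rewrite addr_ge0 ?sqr_ge0.
have c1 : -1 <= Re w / r <= 1.
  by rewrite ler_pdivlMr// ler_pdivrMr//; apply/andP; split; nra.
have rE : (1 - (Re w / r) ^+ 2) = (Im w / r) ^+ 2.
  have r0' : r != 0 by rewrite gt_eqF.
  apply: (mulfI (expf_neq0 2 r0')); rewrite mulrBr mulr1 !exprMn !exprVn.
  rewrite 2!(mulrCA (r ^+ 2)) mulfV ?expf_neq0// !mulr1; lra.
pose t0 := acos (Re w / r); pose t := if 0 <= Im w then t0 else - t0.
have ct : cos t = Re w / r by rewrite /t; case: ifP; rewrite ?cosN acosK.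
have st : sin t = Im w / r.
  rewrite /t /t0; case: ifPn => h; rewrite ?sinN sin_acos// rE sqrtr_sqr normrM.
    by rewrite !ger0_norm// invr_ge0 ltW.
  rewrite -ltNge in h.
  by rewrite ltr0_norm// ger0_norm ?invr_ge0 ?ltW// mulNr opprK.
have [m /andP[m1 m2]] := shift_into_period a t l0.
exists (ln r +i* (t + 2 * pi * m%:~R)); split=> //.
rewrite /cexp /= cosD2pi_int sinD2pi_int ct st lnK//.
have r0' : r != 0 by rewrite gt_eqF.
by apply: complexP => /=; field.
Qed.

(** The converse over the reals: it transfers the known derivatives of exp, cos
    and sin to bounds on the remainder of the complex exponential. *)
Lemma is_derive_remainder (f : R -> R) (d : R) : is_derive (0 : R) 1 f d ->
  forall e : R, 0 < e -> exists2 del : R, 0 < del &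
    forall t, `|t| <= del -> `|f t - f 0 - d * t| <= e * `|t|.
Proof.
move=> [df dE] e e0.
have : (fun h => h^-1 *: ((f \o shift (0 : R)) (h *: (1 : R)) - f 0)) @ 0^' --> d.
  by rewrite -dE; exact: df.
move=> /cvgrPdist_le /(_ e e0); rewrite near_withinE => /nbhs_ballP[del /= del0 H].
exists (del / 2) => [|t tdel]; first by lra.
have [->|t0] := eqVneq t 0; first by rewrite subrr sub0r mulr0 oppr0 normr0 mulr0.
have := H t; rewrite /ball /= sub0r normrN => /(_ _ t0) /=.
rewrite addr0 [_ *: 1]mulr1 => H'.
have -> : f t - f 0 - d * t = - ((d - t^-1 * (f t - f 0)) * t) by field.
rewrite normrN normrM ler_wpM2r//; apply: H'; lra.
Qed.

Lemma normc_ge0 w : 0 <= Normc.normc w.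
Proof. by case: w => a b /=; rewrite sqrtr_ge0. Qed.

Lemma normRe_le w : `|Re w| <= Normc.normc w.
Proof.
by case: w => a b /=; rewrite -sqrtr_sqr ler_wsqrtr// lerDl sqr_ge0.
Qed.

Lemma normIm_le w : `|Im w| <= Normc.normc w.
Proof.
by case: w => a b /=; rewrite -sqrtr_sqr ler_wsqrtr// lerDr sqr_ge0.
Qed.

Lemma normc_le w : Normc.normc w <= `|Re w| + `|Im w|.
Proof.
case: w => a b /=; rewrite -[leRHS]ger0_norm ?addr_ge0// -sqrtr_sqr ler_wsqrtr//.
rewrite sqrrD !real_normK ?num_real//.
have := mulr_ge0 (normr_ge0 a) (normr_ge0 b); lra.
Qed.

(** With w = a + i b, the real part of the remainder is
    exp a (cos b - 1) + (exp a - 1 - a) and the imaginary part is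
    exp a (sin b - b) + (exp a - 1) b; each term is small relative to |w| by the
    real derivatives at 0, the last one because it is of second order. *)
Lemma cexp_remainder (e : R) : 0 < e -> exists2 del : R, 0 < del &
  forall w, Normc.normc w <= del -> Normc.normc (cexp w - 1 - w) <= e * Normc.normc w.
Proof.
move=> e0; pose e1 := Num.min 1 (e / 9).
have [e1_0 e1_1 e1_e] : [/\ 0 < e1, e1 <= 1 & 9 * e1 <= e].
  by rewrite /e1; case: (leP 1 (e / 9)) => h; split; lra.
clearbody e1.
have dexp := is_derive_expR (0 : R); rewrite expR0 in dexp.
have dcos := is_derive_cos (0 : R); rewrite sin0 oppr0 in dcos.
have dsin := is_derive_sin (0 : R); rewrite cos0 in dsin.
have [d1 d1_0 D1] := is_derive_remainder dexp e1_0.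
have [d2 d2_0 D2] := is_derive_remainder dcos e1_0.
have [d3 d3_0 D3] := is_derive_remainder dsin e1_0.
(* The bound by e1 on |a| makes the second-order term small. *)
exists (Num.min e1 (Num.min d1 (Num.min d2 d3))); first by rewrite !lt_min e1_0 d1_0 d2_0.
move=> w; rewrite !le_min => /and4P[n0 n1 n2 n3].
have N0 := normc_ge0 w; have Na := normRe_le w; have Nb := normIm_le w.
have := D1 (Re w) (le_trans Na n1); have := D2 (Im w) (le_trans Nb n2).
have := D3 (Im w) (le_trans Nb n3).
rewrite sin0 cos0 expR0 mul0r !mul1r !subr0.
have -> : cexp w - 1 - w = (expR (Re w) * cos (Im w) - 1 - Re w) +i*
   (expR (Re w) * sin (Im w) - Im w).
  by rewrite /cexp; apply: complexP; case: (w) => a b /=; simpc => /=; ring.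
move: (Normc.normc w) N0 Na Nb n0 {n1 n2 n3} (normc_le ((expR (Re w) * cos (Im w) - 1 - Re w) +i*
   (expR (Re w) * sin (Im w) - Im w))) => N /=.
move: (expR (Re w)) (cos (Im w)) (sin (Im w)) => E c s.
move: (Re w) (Im w) => a b N0 Na Nb n0 h hs hc hE.
apply: le_trans h _.
have hE1 : `|E - 1| <= 2 * `|a|.
  have -> : E - 1 = (E - 1 - a) + a by ring.
  apply: le_trans (ler_normD _ _) _.
  have := ler_wpM2r (normr_ge0 a) e1_1; lra.
have hE3 : `|E| <= 3.
  have -> : E = (E - 1) + 1 by ring.
  by apply: le_trans (ler_normD _ _) _; rewrite normr1; lra.
have b1 : `|E * c - 1 - a| <= 4 * e1 * N.
  have -> : E * c - 1 - a = E * (c - 1) + (E - 1 - a) by ring.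
  apply: le_trans (ler_normD _ _) _; rewrite normrM.
  have := ler_pM (normr_ge0 _) (normr_ge0 _) hE3 hc.
  have := ler_wpM2l (ltW e1_0) Na; have := ler_wpM2l (ltW e1_0) Nb; lra.
have b2 : `|E * s - b| <= 5 * e1 * N.
  have -> : E * s - b = E * (s - b) + (E - 1) * b by ring.
  apply: le_trans (ler_normD _ _) _; rewrite !normrM.
  have := ler_pM (normr_ge0 _) (normr_ge0 _) hE3 hs.
  have := ler_pM (normr_ge0 _) (normr_ge0 _) hE1 Nb.
  have := ler_wpM2r N0 (le_trans Na n0).
  have := ler_wpM2l (ltW e1_0) Nb; lra.
have := ler_wpM2r N0 e1_e; lra.
Qed.

Lemma norm_normc w : `|w| = (Normc.normc w)%:C. Proof. by []. Qed.

(** By the addition formula the remainder at z is the one at 0 times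
    [cexp (c * z)]. *)
Lemma is_derive_cexp_scale (c z : R[i]^o) :
  is_derive z (1 : R[i]^o) (fun z : R[i]^o => cexp (c * z) : R[i]^o) (c * cexp (c * z)).
Proof.
apply: is_derive_from_remainder => eps eps0.
have [e0 eE] : 0 < Re eps /\ eps = (Re eps)%:C.
  by move: eps0; case: (eps) => a b; simpc => /andP[/eqP -> ->].
rewrite {}eE {eps0}; move: (Re eps) e0 => e e0.
set k := Normc.normc (c * cexp (c * z)).
have k0 : 0 <= k := normc_ge0 _.
have n0 := normc_ge0 c.
have e'0 : 0 < e / (k + 1) by rewrite divr_gt0//; lra.
have [d d0 D] := cexp_remainder e'0.
exists ((d / (Normc.normc c + 1))%:C).
  by rewrite ltcR divr_gt0//; lra.
move=> h; rewrite !norm_normc -rmorphM lecR ltcR => hd.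
have -> : cexp (c * (h *: (1 : R[i]^o) + z)) - cexp (c * z) - h *: (c * cexp (c * z)) =
    (cexp (c * h) - 1 - c * h) * cexp (c * z) :> R[i]^o.
  have -> : h *: (1 : R[i]^o) = h by exact: mulr1.
  have -> : h *: (c * cexp (c * z)) = h * (c * cexp (c * z)) by [].
  by rewrite mulrDr cexpD; ring.
rewrite Normc.normcM.
have hd' : Normc.normc (c * h) <= d.
  rewrite Normc.normcM; move: hd; rewrite ltr_pdivlMr; last by lra.
  have := normc_ge0 h; nra.
have := ler_wpM2r (normc_ge0 (cexp (c * z))) (D _ hd').
move/le_trans; apply.
have -> : e / (k + 1) * Normc.normc (c * h) * Normc.normc (cexp (c * z)) =
    e * Normc.normc h * (k / (k + 1)).
  have k1 : k + 1 != 0 by rewrite gt_eqF//; lra.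
  by move: k1; rewrite /k !Normc.normcM => k1; field.
apply: ler_piMr; first by rewrite mulr_ge0 ?normc_ge0 ?ltW.
by rewrite ler_pdivrMr; lra.
Qed.

End ComplexExponential.

(** * The exponential of a vertical strip *)

Section StripExponential.
Variable R : realType.
Implicit Types (a l x y t u : R) (z w : R[i]^o).

(** The map phi_n depends on n only through l = l_(n-1), so its analysis is done
    for an arbitrary period l. *)
Definition stripexp l z : R[i]^o :=
  cexp (- (((2 * pi) *i : R[i]^o) * z / l%:C)).

Lemma stripexpE l z : 0 < l ->
  stripexp l z = cexp ((2 * pi * Im z / l) +i* (- (2 * pi * Re z / l))).
Proof.
move=> l0; have l0' : l != 0 by rewrite gt_eqF.
congr cexp; case: z => x y; apply: complexP; simpc => /=; field; exact: l0'.
Qed.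

Lemma norm_stripexp l z : 0 < l -> `|stripexp l z| = (expR (2 * pi * Im z / l))%:C.
Proof. by move=> l0; rewrite stripexpE// norm_normc normc_cexp. Qed.

Lemma stripexp_norm_le1 l z : 0 < l -> (`|stripexp l z| <= 1) = (Im z <= 0).
Proof.
move=> l0; have pp := pi_gt0 R; rewrite norm_stripexp// (_ : 1 = 1%:C)// lecR -[leRHS]expR0 ler_expR.
by rewrite pmulr_lle0 ?invr_gt0// pmulr_rle0//; lra.
Qed.

Lemma stripexp_norm_lt1 l z : 0 < l -> (`|stripexp l z| < 1) = (Im z < 0).
Proof.
move=> l0; have pp := pi_gt0 R; rewrite norm_stripexp// (_ : 1 = 1%:C)// ltcR -[ltRHS]expR0 ltr_expR.
by rewrite pmulr_llt0 ?invr_gt0// pmulr_rlt0//; lra.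
Qed.

Lemma stripexp_neq0 l z : stripexp l z != 0.
Proof. exact: cexp_neq0. Qed.

Lemma rotationD t u z : rotation (t + u) z = rotation t (rotation u z).
Proof.
rewrite /rotation mulrA -cexpD; congr (cexp _ * _).
by apply: complexP; simpc => /=; ring.
Qed.

Lemma rotation_int (m : int) z : rotation m%:~R z = z.
Proof.
rewrite /rotation -[RHS]mul1r; congr (_ * _).
rewrite /cexp /= expR0 -[_ * _%:~R]add0r cosD2pi_int sinD2pi_int cos0 sin0.
by apply: complexP => /=; ring.
Qed.

Lemma iter_rotation (k : nat) t z : iter k (rotation t) z = rotation (k%:R * t) z.
Proof.
elim: k => [|k IH]; first by rewrite mul0r -[0]/(0%:~R) rotation_int.
by rewrite iterS IH -rotationD; congr rotation; rewrite -natr1; ring.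
Qed.

Lemma stripexp_translate l x z : 0 < l ->
  stripexp l (z + x%:C) = rotation (- (x / l)) (stripexp l z).
Proof.
move=> l0; have l0' : l != 0 by rewrite gt_eqF.
rewrite !stripexpE// /rotation -cexpD; congr cexp.
case: z => a b; apply: complexP; simpc => /=; field; exact: l0'.
Qed.

Lemma stripexp_period l z (m : int) : 0 < l ->
  stripexp l (z + (l * m%:~R)%:C) = stripexp l z.
Proof.
move=> l0; have l0' : l != 0 by rewrite gt_eqF.
by rewrite stripexp_translate// mulrAC divff// mul1r -rmorphN rotation_int.
Qed.

Lemma stripexp_eq l z w : 0 < l -> stripexp l z = stripexp l w ->
  exists m : int, z = w + (l * m%:~R)%:C.
Proof.
move=> l0; have l0' : l != 0 by rewrite gt_eqF.
have pp := pi_gt0 R.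
rewrite !stripexpE// => /cexp_eq /= [hI [m hR]]; exists (- m).
have c0 : 2 * pi / l != 0 by rewrite mulf_neq0 ?invr_neq0//; lra.
rewrite rmorphN; apply: complexP; case: z w hI hR => a b [c d] /= hI hR.
  apply: (mulfI c0); rewrite [RHS]mulrDr.
  have -> : 2 * pi / l * (l * - m%:~R) = - (2 * pi * m%:~R) by field.
  by move: hR; rewrite !(mulrAC (2 * pi) _ l^-1); lra.
apply: (mulfI c0); rewrite [RHS]mulrDr mulr0 addr0.
by move: hI; rewrite !(mulrAC (2 * pi) _ l^-1).
Qed.

Lemma stripexp_surj l a w : 0 < l -> w != 0 ->
  exists z : R[i]^o, stripexp l z = w /\ a <= Re z < a + l.
Proof.
move=> l0 w0; have l0' : l != 0 by rewrite gt_eqF.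
have pp := pi_gt0 R; have p0 : pi != 0 :> R by lra.
have [z [<- _ _]] := cexp_surj 0 w0.
have [m mP] := shift_into_period a (- (Im z * l / (2 * pi))) l0.
pose z' := (- (Im z * l / (2 * pi))) +i* (Re z * l / (2 * pi)) : R[i]^o.
exists (z' + (l * m%:~R)%:C); split=> //.
rewrite stripexp_period// stripexpE//; congr cexp.
by apply: complexP; rewrite /z' /=; move: (pi : R) p0 => p p0; field; rewrite l0' p0.
Qed.

(** The angles of the strip [- l/2, l/2[ are the principal ones. *)
Lemma carg_stripexp l z : 0 < l -> - (l / 2) <= Re z < l / 2 ->
  carg (stripexp l z) = - (2 * pi * Re z / l).
Proof.
move=> l0 /andP[h1 h2]; have pp := pi_gt0 R; rewrite stripexpE// carg_cexp//=.
have q1 : - (1 / 2) <= Re z / l by rewrite ler_pdivlMr//; lra.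
have q2 : Re z / l < 1 / 2 by rewrite ltr_pdivrMr//; lra.
rewrite -mulrA; apply/andP; split; nra.
Qed.

(** Where the exponent gives the principal argument, the branch of z^(1/|t|)
    divides it by |t|, that is, it multiplies the period by |t|. *)
Lemma psi_stripexp l t z : 0 < l -> t != 0 -> - (l / 2) <= Re z < l / 2 ->
  psi t (stripexp l z) = stripexp (`|t| * l) z.
Proof.
move=> l0 t0 zl; have l0' : l != 0 by rewrite gt_eqF.
have T0 : 0 < `|t| by rewrite normr_gt0.
have T0' : `|t| != 0 by rewrite gt_eqF.
rewrite /psi carg_stripexp// !stripexpE ?mulr_gt0// normc_cexp -expRM.
rewrite /cexp /= expR0.
have -> : 2 * pi * Im z / (`|t| * l) = 2 * pi * Im z / l * (1 / `|t|).
  by move: (`|t|) T0' => T T0'; field; rewrite l0' T0'.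
have -> : - (2 * pi * Re z / (`|t| * l)) = - (2 * pi * Re z / l) / `|t|.
  by move: (`|t|) T0' => T T0'; field; rewrite l0' T0'.
by rewrite div1r rmorph1 [1 * (_ +i* _)]mul1r.
Qed.

End StripExponential.

(** * Open strips and conformality *)

Section PlaneTopology.
Variable R : realType.
Implicit Types (a b l x y t u e : R) (z w : R[i]^o).

Lemma nbhs_complexP z (A : set R[i]^o) :
  nbhs z A <-> exists2 e : R, 0 < e & forall w, Normc.normc (w - z) < e -> A w.
Proof.
split=> [/nbhs_ballP[e /= e0 H] | [e e0 H]].
  have [e0' eE] : 0 < Re e /\ e = (Re e)%:C.
    by move: e0; case: (e) => u v; simpc => /andP[/eqP -> ->].
  exists (Re e) => // w wz; apply: H; rewrite /ball /= eE distrC norm_normc ltcR //.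
apply/nbhs_ballP; exists (e%:C) => /=; first by rewrite ltcR.
by move=> w; rewrite /ball /= distrC norm_normc ltcR; apply: H.
Qed.

Lemma open_strip a b : open ([set z | a < Re z < b] : set R[i]^o).
Proof.
rewrite openE => z /= /andP[h1 h2]; apply/nbhs_complexP.
exists (Num.min (Re z - a) (b - Re z)); first by rewrite lt_min !subr_gt0 h1 h2.
move=> w; rewrite lt_min => /andP[n1 n2].
have := normRe_le (w - z); rewrite raddfB ler_norml => /andP[q1 q2].
by apply/andP; split; lra.
Qed.

(** An interior point can be moved both ways inside A. *)
Lemma interior_segment_lt (A : set R) a b x :
  (forall y, A y -> a <= y <= b) -> A° x -> a < x < b.
Proof.
move=> Aab /nbhs_ballP[e /= e0 H].
have /Aab/andP[h1 _] : A (x - e / 2).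
  by apply: H; rewrite /ball /= opprB addrCA subrr addr0 gtr0_norm; lra.
have /Aab/andP[_ h2] : A (x + e / 2).
  by apply: H; rewrite /ball /= opprD addrA subrr sub0r normrN gtr0_norm; lra.
by apply/andP; split; lra.
Qed.

Lemma interior_halfStrip a b :
  (halfStrip [set x | a <= x <= b])° = [set z : R[i]^o | Im z < 0 /\ a < Re z < b].
Proof.
apply/seteqP; split=> z /=.
  move=> /nbhs_complexP[e e0 H].
  have H' u v : `|u| + `|v| < e -> Im z + v <= 0 /\ a <= Re z + u <= b.
    move=> uv; have := H (z + (u +i* v)); rewrite addrAC subrr add0r.
    move=> /(_ (le_lt_trans (normc_le (u +i* v)) uv)).
    by case: (z) => x y /=.
  have := H' 0 (e / 2); rewrite normr0 add0r gtr0_norm; last by lra.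
  have := H' (e / 2) 0; rewrite normr0 addr0 gtr0_norm; last by lra.
  have := H' (- (e / 2)) 0; rewrite normrN normr0 addr0 gtr0_norm; last by lra.
  have -> : (e / 2 < e) by lra.
  move=> /(_ isT)[_ /andP[h1 _]] /(_ isT)[_ /andP[_ h2]] /(_ isT)[h3 _].
  by split; [lra | apply/andP; split; lra].
move=> [h0 /andP[h1 h2]]; apply/nbhs_complexP.
exists (Num.min (- Im z) (Num.min (Re z - a) (b - Re z))).
  by rewrite !lt_min !subr_gt0 oppr_gt0 h0 h1 h2.
move=> w; rewrite !lt_min => /and3P[n0 n1 n2].
have := normRe_le (w - z); have := normIm_le (w - z).
rewrite !raddfB !ler_norml => /andP[p1 p2] /andP[p3 p4].
by split=> /=; [lra | apply/andP; split; lra].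
Qed.

(** An open strip of width l that contains A serves as the neighbourhood: the
    derivative of an exponential never vanishes, and the strip is too narrow to
    contain two points that differ by a nonzero period. *)
Lemma stripexp_conformal l a (A : set R[i]^o) : 0 < l ->
  (forall z, A z -> a < Re z < a + l) ->
  conformal_onto (stripexp l) A (stripexp l @` A).
Proof.
move=> l0 Al; have l0' : l != 0 by rewrite gt_eqF.
have pp := pi_gt0 R.
exists [set z | a < Re z < a + l]; split=> //.
- exact: open_strip.
- move=> z w; rewrite !inE /= => /andP[z1 z2] /andP[w1 w2] /stripexp_eq[]// m zw.
  have : Re z = Re w + l * m%:~R by rewrite zw; case: (w).
  move: zw; case: (intP m) => [|k|k].
  + by rewrite mulr0 addr0.
  + have : (1 : R) <= k.+1%:~R by rewrite ler1n.
    by move=> k1 _ zw; exfalso; nra.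
  + have : (1 : R) <= k.+1%:~R by rewrite ler1n.
    by move=> k1 _; rewrite mulrNz => zw; exfalso; nra.
- move=> z _.
  pose c : R[i]^o := - ((2 * pi) *i / l%:C).
  have E : stripexp l = fun z => cexp (c * z) :> R[i]^o.
    by apply/funext => u; rewrite /stripexp /c; congr cexp; rewrite mulNr mulrAC.
  have [dz Dz] := is_derive_cexp_scale c z.
  rewrite E; split => //; rewrite Dz mulf_neq0 ?cexp_neq0// oppr_eq0 mulf_neq0//.
    by apply/eqP => -[] /eqP; apply/negP; lra.
  by rewrite invr_eq0; apply/eqP => -[] /eqP; apply/negP.
Qed.

End PlaneTopology.

(** * Lengths and intervals *)

Section Lengths.
Variables (R : realType) (s : int -> Sigma).
Implicit Types (n k : int) (j : bool) (x y : R).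
Local Notation e k := ((eps s k)%:~R : R).
Local Notation l k := (len R s k).

Lemma eps_sqr k : e k * e k = 1.
Proof. by case: (epsRP R s k) => ->; ring. Qed.

(** The continued fraction step in absolute values, using that theta_n has the
    sign of eps (n + 1). *)
Lemma inv_norm_theta n : `|theta R s n|^-1 =
  (abar s (n + 1))%:R + (1 + e (n + 1) * e (n + 1 + 1)) / 2
    - e (n + 1) * e (n + 1 + 1) * `|theta R s (n + 1)|.
Proof.
have [d0 Dn] := theta_rec R s n.
rewrite !theta_norm {1}Dn invfM invrK rmorphM /= bR.
case: (epsRP R s (n + 1)) => ->; case: (epsRP R s (n + 1 + 1)) => ->; rewrite ?invrN ?invr1; lra.
Qed.

(** The bound is strict because theta_(n+1) is not 0.  Strictness is what keeps
    the angle of the slit away from the jump of the principal argument. *)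
Lemma theta_lt_half n : `|theta R s n| < 1 / 2.
Proof.
have t0 : 0 < `|theta R s n| by rewrite normr_gt0 theta_neq0.
have t1 : 0 < `|theta R s (n + 1)| by rewrite normr_gt0 theta_neq0.
have [t2 _] := theta_bound R s (n + 1).
have a2 : 2 <= (abar s (n + 1))%:R :> R by rewrite ler_nat abar_ge2.
have : 2 < `|theta R s n|^-1.
  rewrite inv_norm_theta.
  by case: (epsRP R s (n + 1)) => ->; case: (epsRP R s (n + 1 + 1)) => ->; lra.
have := mulfV (lt0r_neq0 t0); nra.
Qed.

(** According to the sign of eps (n + 1) * eps (n + 2), the inverse of |theta_n| is
    abar + 1 - |theta_(n+1)| or abar + |theta_(n+1)|. *)
Lemma floor_inv_theta n : Num.floor (1 / `|theta R s n|) = abar s (n + 1).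
Proof.
apply: floor_def; rewrite div1r inv_norm_theta intrD.
have t1 : 0 < `|theta R s (n + 1)| by rewrite normr_gt0 theta_neq0.
have [t2 _] := theta_bound R s (n + 1).
rewrite -pmulrn.
by case: (epsRP R s (n + 1)) => ->; case: (epsRP R s (n + 1 + 1)) => ->; apply/andP; split; lra.
Qed.

Lemma len_gt0 n : 0 < l n.
Proof.
case: n => k; rewrite /len ?invr_gt0; apply: prodr_gt0 => i _;
  by rewrite normr_gt0 theta_neq0.
Qed.

Lemma len_lt_half n : l n < l (n - 1) / 2.
Proof.
rewrite len_rec; have := theta_lt_half n; have := len_gt0 (n - 1); nra.
Qed.

Lemma theta_len n : theta R s n = e (n + 1) * (l n / l (n - 1)).
Proof.
rewrite len_rec mulfK; last by rewrite gt_eqF// len_gt0.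
by rewrite theta_norm mulrA eps_sqr mul1r.
Qed.

(** The relation of the time group, read on the translation lengths. *)
Lemma len_three_term n : l (n - 1) = (abar s (n + 1))%:R * l n
  + (1 + e (n + 1) * e (n + 1 + 1)) / 2 * l n - e (n + 1) * e (n + 1 + 1) * l (n + 1).
Proof.
rewrite [l (n + 1)]len_rec addrK.
have -> : l (n - 1) = `|theta R s n|^-1 * l n.
  by rewrite (len_rec R s n) mulKf// normr_eq0 theta_neq0.
by rewrite inv_norm_theta; ring.
Qed.

Lemma transl_retTime k j :
  transl R (retTime s k j) = e (k + 1) * (j%:R * l (k - 1) - l k).
Proof.
rewrite /retTime raddfB raddfMz /= !transl_Q subrK -[_ *~ (_ *+ j)]mulrzl.
have -> : (eps s k * eps s (k + 1) *+ j)%:~R = e k * e (k + 1) * j%:R :> R.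
  by case: j; rewrite ?mulr1n ?mulr0n ?mulr1 ?mulr0 ?rmorphM.
by case: j; case: (epsRP R s k) => ->; case: (epsRP R s (k + 1)) => -> /=; lra.
Qed.

(** The endpoint l_k - l_(k-1) or - l_k of J_k, according to the sign
    eps (k + 1); J_k has length l_(k-1) in both cases. *)
Definition Jleft k : R := e (k + 1) * l k - (1 + e (k + 1)) / 2 * l (k - 1).

Lemma segP x y u : seg x y u <-> Num.min x y <= u <= Num.max x y.
Proof. by rewrite /seg /= in_itv. Qed.

Lemma seg_le x y u : x <= y -> seg x y u <-> x <= u <= y.
Proof. by move=> xy; rewrite segP (min_idPl xy) (max_idPr xy). Qed.

Lemma segC x y : seg x y = seg y x.
Proof. by rewrite /seg minC maxC. Qed.

Lemma Re_V (P : TimeGroup s) : Re (V R P) = transl R P.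
Proof. by rewrite /V /F add0r. Qed.

Lemma Re_FE (P : TimeGroup s) (z : R[i]^o) : Re (F P z) = Re z + transl R P.
Proof. by case: z. Qed.

Lemma Im_FE (P : TimeGroup s) (z : R[i]^o) : Im (F P z) = Im z.
Proof. by case: z => x y; rewrite /F /= addr0. Qed.

Lemma JjE k j x : Jj R s k j x <->
  if j then 0 <= e (k + 1) * x <= l k else l k - l (k - 1) <= e (k + 1) * x <= 0.
Proof.
rewrite /Jj !Re_V !raddfN /= !transl_retTime.
have := len_gt0 k; have := len_lt_half k.
case: j; case: (epsRP R s (k + 1)) => -> /= h1 h2.
- rewrite segC seg_le; last by lra.
  by split=> /andP[? ?]; apply/andP; split; lra.
- rewrite seg_le; last by lra.
  by split=> /andP[? ?]; apply/andP; split; lra.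
- rewrite segC seg_le; last by lra.
  by split=> /andP[? ?]; apply/andP; split; lra.
- rewrite seg_le; last by lra.
  by split=> /andP[? ?]; apply/andP; split; lra.
Qed.

Lemma J_E k : J R s k = [set x | Jleft k <= x <= Jleft k + l (k - 1)].
Proof.
have l0 := len_gt0 k; have l1 := len_lt_half k.
rewrite /Jleft; apply/seteqP; split=> x /=.
  move=> [] /JjE; case: (epsRP R s (k + 1)) => -> /andP[? ?]; apply/andP; split; lra.
case: (epsRP R s (k + 1)) => eE; rewrite eE => /andP[? ?]; have [?|?] := leP 0 x.
- by left; apply/JjE; rewrite eE; apply/andP; split; lra.
- by right; apply/JjE; rewrite eE; apply/andP; split; lra.
- by right; apply/JjE; rewrite eE; apply/andP; split; lra.
- by left; apply/JjE; rewrite eE; apply/andP; split; lra.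
Qed.

(** The intervals J'_(k,0) and J'_(k,1) are the translates of J_(k,0) and J_(k,1)
    that fill J_k in the opposite order. *)
Lemma Jj'_bound k j x : Jj' R s k j x ->
  if j then l k - l (k - 1) <= e (k + 1) * x <= 2 * l k - l (k - 1)
  else 2 * l k - l (k - 1) <= e (k + 1) * x <= l k.
Proof.
move=> [y /JjE]; rewrite Re_FE raddfN /= transl_retTime => yJ <-.
by move: yJ; case: j; case: (epsRP R s (k + 1)) => -> /= /andP[? ?]; apply/andP; split; lra.
Qed.

Lemma Jj'_interior k j x : (Jj' R s k j)° x ->
  if j then l k - l (k - 1) < e (k + 1) * x < 2 * l k - l (k - 1)
  else 2 * l k - l (k - 1) < e (k + 1) * x < l k.
Proof.
have := @Jj'_bound k j; case: (epsRP R s (k + 1)) => -> B xJ.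
  have : if j then - (2 * l k - l (k - 1)) < x < - (l k - l (k - 1))
         else - l k < x < - (2 * l k - l (k - 1)).
    by move: B xJ; case: j => B xJ; apply: (interior_segment_lt _ xJ) => y /B /andP[? ?];
      apply/andP; split; lra.
  by case: j {B xJ} => /andP[? ?]; apply/andP; split; lra.
have : if j then l k - l (k - 1) < x < 2 * l k - l (k - 1)
       else 2 * l k - l (k - 1) < x < l k.
  by move: B xJ; case: j => B xJ; apply: (interior_segment_lt _ xJ) => y /B /andP[? ?];
      apply/andP; split; lra.
by case: j {B xJ} => /andP[? ?]; apply/andP; split; lra.
Qed.

(** The endpoints of J_(k+1) are at distance less than l_k from 0, those of J_k at
    distance at least l_k, since 2 l_k < l_(k-1). *)
Lemma J_step k x : J R s (k + 1) x -> Jleft k < x < Jleft k + l (k - 1).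
Proof.
rewrite J_E /= /Jleft addrK.
have := len_gt0 k; have := len_lt_half k; have := len_gt0 (k + 1).
have := len_lt_half (k + 1); rewrite addrK.
case: (epsRP R s (k + 1)) => ->; case: (epsRP R s (k + 1 + 1)) => -> ? ? ? ? /andP[? ?];
  by apply/andP; split; lra.
Qed.

Lemma J_strictly_nested k (m : nat) x : J R s (k + 1 + m%:Z) x -> Jleft k < x < Jleft k + l (k - 1).
Proof.
elim: m x => [|m IH] x; first by rewrite addr0; exact: J_step.
rewrite -addn1 PoszD addrA => /J_step /andP[h1 h2]; apply: IH.
by rewrite J_E /= !ltW.
Qed.

End Lengths.

(** * The slit disk and the sectors *)

Section Disk.
Variables (R : realType) (s : int -> Sigma).
Implicit Types (n k : int) (j : bool) (x y t u : R) (z w : R[i]^o).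
Local Notation e k := ((eps s k)%:~R : R).
Local Notation l k := (len R s k).

Lemma phiE n : phi R s n = stripexp (l (n - 1)). Proof. by []. Qed.

(** Two points that are identified modulo the period a and are less than a apart
    coincide. *)
Lemma mul_int_small (a : R) (m : int) : 0 < a -> - a < a * m%:~R < a -> m = 0.
Proof.
move=> a0 /andP[h1 h2].
have : -1 < m%:~R :> R by rewrite -(ltr_pM2l a0) mulrN1.
have : m%:~R < 1 :> R by rewrite -(ltr_pM2l a0) mulr1.
by rewrite -[1]/(1%:~R) -mulrNz !ltr_int; lia.
Qed.

Lemma Re_addR z x : Re (z + x%:C) = Re z + x. Proof. by case: z. Qed.

Lemma Im_addR z x : Im (z + x%:C) = Im z. Proof. by case: z => a b /=; rewrite addr0. Qed.

Lemma W_interior n : (W R s n)° =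
  [set z | Im z < 0 /\ Jleft R s n < Re z < Jleft R s n + l (n - 1)].
Proof. by rewrite /W J_E interior_halfStrip. Qed.

Lemma verticalSideP n j z : verticalSide R s n j z <->
  Im z <= 0 /\ Re z = e (n + 1) * l n - e (n + 1) * l (n - 1) * j%:R.
Proof.
rewrite /verticalSide Re_V raddfN /= transl_retTime.
by split=> -[h1 h2]; split=> //=; rewrite h2; ring.
Qed.

(** The endpoint eps (n + 1) * l_n of J_n has angle - 2 pi theta_n; the other
    endpoint differs from it by one period. *)
Lemma phi_slit n j : phi R s n @` verticalSide R s n j = slit R s n `\ 0.
Proof.
have l0 := len_gt0 R s n; have l1 := len_gt0 R s (n - 1); have l2 := len_lt_half R s n.
have pp := pi_gt0 R.
have l1' : l (n - 1) != 0 by rewrite gt_eqF.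
have slope z : Im z <= 0 -> Re z = e (n + 1) * l n -> slit R s n (phi R s n z).
  move=> z0 zr; split; first by rewrite /closedDisk /= phiE stripexp_norm_le1.
  right; rewrite phiE carg_stripexp// ?zr ?theta_len ?mulrA//.
  by case: (epsRP R s (n + 1)) => ->; apply/andP; split; lra.
pose c : int := eps s (n + 1) * j.
have cE : c%:~R = e (n + 1) * j%:R by rewrite /c rmorphM /= -pmulrn.
have per z : phi R s n (z + (l (n - 1) * c%:~R)%:C) = phi R s n z.
  exact: stripexp_period.
apply/seteqP; split=> w /=.
  move=> [z /verticalSideP[z0 zr] <-]; split; last by apply/eqP; rewrite phiE stripexp_neq0.
  rewrite -per; apply: slope; first by rewrite Im_addR.
  by rewrite Re_addR zr cE; ring.
move=> [[w1 [//|wa]] /eqP w0].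
have [z [zw zr]] := stripexp_surj (- (l (n - 1) / 2)) l1 w0.
move: w1; rewrite /closedDisk /= -zw stripexp_norm_le1// => z0.
have zr' : Re z = e (n + 1) * l n.
  move: wa; rewrite -zw carg_stripexp//; last by move: zr => /andP[? ?]; apply/andP; split; lra.
  move=> /oppr_inj; rewrite theta_len -[_ * _ / _]mulrA => /mulfI wa.
  have /wa : 2 * pi != 0 :> R by rewrite gt_eqF//; lra.
  by rewrite mulrA => /(mulIf (invr_neq0 l1')).
exists (z + (l (n - 1) * (- c)%:~R)%:C); last by rewrite phiE stripexp_period.
apply/verticalSideP; rewrite Im_addR Re_addR zr' mulrNz cE; split=> //; ring.
Qed.

(** A half-open strip of width one period maps bijectively onto the punctured
    disk, and its closed edge is a vertical side, whose image is the slit. *)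
Lemma phi_interior_image n :
  phi R s n @` (W R s n)° = openDisk R `\` slit R s n.
Proof.
have l0 := len_gt0 R s n; have l1 := len_gt0 R s (n - 1); have l2 := len_lt_half R s n.
rewrite W_interior; apply/seteqP; split=> w /=.
  move=> [z [z0 /andP[z1 z2]] <-]; split; first by rewrite /openDisk /= phiE stripexp_norm_lt1.
  move=> zs; have : (slit R s n `\ 0) (phi R s n z).
    by split=> //=; apply/eqP; rewrite phiE stripexp_neq0.
  rewrite -(phi_slit n (e (n + 1) == 1)) => -[z' /verticalSideP[z'0 z'r]].
  rewrite phiE => /stripexp_eq[]// m /(congr1 (fun u : R[i]^o => Re u)).
  rewrite Re_addR => hm.
  have zJ : Re z' = Jleft R s n.
    rewrite z'r /Jleft; case: (epsRP R s (n + 1)) => ->; rewrite ?eqxx /=; first last.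
      by field.
    by rewrite (_ : (-1 == 1 :> R) = false) /=; [ring | apply/eqP; lra].
  have m0 : m = 0 by apply: (mul_int_small l1); lra.
  by move: hm z1; rewrite m0 mulr0 addr0 => <-; rewrite zJ ltxx.
move=> [w1 ws].
have w0 : w != 0 by apply: contra_notN ws => /eqP ->; split; [rewrite /closedDisk /= normr0|left].
have [z [zw /andP[z1 z2]]] := stripexp_surj (Jleft R s n) l1 w0.
have z0 : Im z < 0 by move: w1; rewrite /openDisk /= -zw stripexp_norm_lt1.
exists z => //; split=> //; rewrite z2 andbT lt_neqAle z1 andbT.
apply/eqP => zJ; apply: ws.
suff : (slit R s n `\ 0) w by case.
rewrite -(phi_slit n (e (n + 1) == 1)); exists z => //; apply/verticalSideP.
split; first exact: ltW.
rewrite -zJ /Jleft; case: (epsRP R s (n + 1)) => ->; rewrite ?eqxx /=; first last.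
  by field.
by rewrite (_ : (-1 == 1 :> R) = false) /=; [ring | apply/eqP; lra].
Qed.

(** The translation Q_[n-1] is by one period of phi_n. *)
Lemma phi_F_lattice n (m p : int) z :
  phi R s n (F (Q s n *~ m + Q s (n - 1) *~ p) z) =
  rotation (m%:~R * theta R s n) (phi R s n z).
Proof.
have l1 := len_gt0 R s (n - 1); have l1' : l (n - 1) != 0 by rewrite gt_eqF.
rewrite /F phiE stripexp_translate// raddfD !raddfMz /= !transl_Q subrK.
rewrite -[in RHS](rotation_int (eps s n * p) (stripexp _ _)) -rotationD; congr rotation.
rewrite theta_len rmorphM /= -[_ *~ m]mulrzl -[_ *~ p]mulrzl; field.
exact: l1'.
Qed.

Lemma retTime_lattice n j :
  retTime s n j = Q s n *~ 1 + Q s (n - 1) *~ (- (eps s n * eps s (n + 1) *+ j)).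
Proof. by rewrite mulr1z mulrNz. Qed.

Lemma circlePtD_int t (m : int) : circlePt (t + m%:~R) = circlePt t.
Proof. by rewrite /circlePt rotationD rotation_int. Qed.

Lemma circlePt_eq t u : circlePt t = circlePt u -> exists m : int, t = u + m%:~R.
Proof.
have pp := pi_gt0 R; have p0 : 2 * pi != 0 :> R by rewrite gt_eqF//; lra.
rewrite /circlePt /rotation !mulr1 => /cexp_eq /= [_ [m h]]; exists m.
by apply: (mulfI p0); rewrite [RHS]mulrDr.
Qed.

Lemma segD x y u v : seg (x + v) (y + v) (u + v) = seg x y u.
Proof.
by apply/propext; rewrite !segP !ge_min !le_max !lerD2r.
Qed.

(** Two lifts of the same pair of endpoints differ by integers; when both are
    closer than half a turn, by the same integer. *)
Lemma shortestArc_circlePt x y w : `|x - y| < 1 / 2 ->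
  shortestArc (circlePt x) (circlePt y) w <-> exists2 u, seg x y u & w = circlePt u.
Proof.
move=> xy; split=> [[x' [y' [u [hx hy]]]] | [u ? ?]]; last by exists x, y, u; split.
have [p xE] := circlePt_eq hx; have [q yE] := circlePt_eq hy.
rewrite xE yE in xy * => xy' xu ->.
have pq : p = q.
  suff : p - q = 0 by lia.
  apply: (@mul_int_small 1) => //; rewrite mul1r rmorphB /=.
  by move: xy xy'; rewrite !ltr_norml => /andP[? ?] /andP[? ?]; apply/andP; split; lra.
by exists (u + q%:~R); rewrite ?circlePtD_int// pq segD.
Qed.

Lemma stripexp_polar a z : 0 < a ->
  stripexp a z = ((expR (2 * pi * Im z / a))%:C : R[i]^o) * circlePt (- (Re z / a)).
Proof.
move=> a0; rewrite stripexpE// /circlePt /rotation /cexp /= expR0 mulr1.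
by rewrite rmorph1 [1 * (_ +i* _)]mul1r mulrN mulrA.
Qed.

(** The shift by eps (n + 1) turns is the one that brings the lifted angles of the
    sector, which are close to - eps (n + 1), back to angles close to 0. *)
Lemma sector1_angles n u :
  seg ((- (abar s (n + 1))%:Z - 1)%:~R * theta R s n) ((- (abar s (n + 1))%:Z)%:~R * theta R s n) u
  <-> J R s (n + 1) (- ((u + e (n + 1)) * l (n - 1))).
Proof.
have l0 := len_gt0 R s n; have l1 := len_gt0 R s (n - 1); have l2 := len_gt0 R s (n + 1).
have lr := len_three_term R s n.
have l1' : l (n - 1) != 0 by rewrite gt_eqF.
set a := (abar s (n + 1))%:R in lr.
have -> : (- (abar s (n + 1))%:Z - 1)%:~R = - a - 1 :> R by rewrite rmorphB /= mulrNz -pmulrn.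
have -> : (- (abar s (n + 1))%:Z)%:~R = - a :> R by rewrite mulrNz -pmulrn.
have T0 : 0 < l n / l (n - 1) by rewrite divr_gt0.
have TL : l n / l (n - 1) * l (n - 1) = l n by rewrite divfK.
rewrite J_E /= /Jleft addrK theta_len; move: (l n / l (n - 1)) T0 TL => T T0 TL.
have scale x y : (x <= y) = (x * l (n - 1) <= y * l (n - 1)) by rewrite ler_pM2r.
case: (epsRP R s (n + 1)) lr => -> lr.
- rewrite segC seg_le; last by lra.
  rewrite scale [(u <= _)]scale.
  have -> : - a * (-1 * T) * l (n - 1) = a * l n by rewrite -TL; ring.
  have -> : (- a - 1) * (-1 * T) * l (n - 1) = (a + 1) * l n by rewrite -TL; ring.
  rewrite mulrBl; case: (epsRP R s (n + 1 + 1)) lr => -> lr;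
    by split=> /andP[? ?]; apply/andP; split; lra.
- rewrite seg_le; last by lra.
  rewrite scale [(u <= _)]scale.
  have -> : - a * (1 * T) * l (n - 1) = - a * l n by rewrite -TL; ring.
  have -> : (- a - 1) * (1 * T) * l (n - 1) = (- a - 1) * l n by rewrite -TL; ring.
  rewrite mulrDl; case: (epsRP R s (n + 1 + 1)) lr => -> lr;
    by split=> /andP[? ?]; apply/andP; split; lra.
Qed.

Lemma sector1_phi n : sector1 (theta R s n) `\ 0 = phi R s n @` W R s (n + 1).
Proof.
have l1 := len_gt0 R s (n - 1); have l1' : l (n - 1) != 0 by rewrite gt_eqF.
have pp := pi_gt0 R.
rewrite /sector1 floor_inv_theta.
set x0 := _%:~R * _; set y0 := _%:~R * _.
have xy : `|x0 - y0| < 1 / 2.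
  have -> : x0 - y0 = - theta R s n by rewrite /x0 /y0 rmorphB /=; ring.
  by rewrite normrN theta_lt_half.
rewrite -/(circlePt x0) -/(circlePt y0).
have secP z : sector (circlePt x0) (circlePt y0) z <->
    exists r u, [/\ 0 <= r <= 1, seg x0 y0 u & z = (r%:C : R[i]^o) * circlePt u].
  split=> [[r [w [r01 /(shortestArc_circlePt w xy)[u xu ->] ->]]] | [r [u [r01 xu ->]]]].
    by exists r, u; split.
  by exists r, (circlePt u); split=> //; apply/(shortestArc_circlePt _ xy); exists u.
apply/seteqP; split=> w /=.
  move=> [/secP[r [u [/andP[r0 r1] xu wE]]] /eqP w0].
  have rp : 0 < r.
    by rewrite lt_neqAle r0 andbT eq_sym; apply: contraNneq w0 => r00; rewrite wE r00 mul0r.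
  have zE : phi R s n ((- ((u + e (n + 1)) * l (n - 1))) +i* (ln r * l (n - 1) / (2 * pi))) = w.
    rewrite phiE stripexp_polar//= wE; congr (_%:C * _).
      rewrite -[RHS]lnK//; congr expR.
      have p0 : pi != 0 :> R by rewrite gt_eqF.
      by move: (pi : R) p0 => p p0; field; rewrite p0 l1'.
    rewrite -[RHS](circlePtD_int _ (eps s (n + 1))); congr circlePt.
    by rewrite mulNr mulfK// opprK.
  exists ((- ((u + e (n + 1)) * l (n - 1))) +i* (ln r * l (n - 1) / (2 * pi))) => //.
  split=> /=; last exact/sector1_angles.
  by rewrite pmulr_lle0 ?invr_gt0 ?pmulr_lle0 ?ln_le0//; lra.
move=> [z [z0 zJ] <-]; split; last by apply/eqP; rewrite phiE stripexp_neq0.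
apply/secP; exists (expR (2 * pi * Im z / l (n - 1))), (- (Re z / l (n - 1)) - e (n + 1)); split.
- rewrite expR_ge0 /= -[leRHS]expR0 ler_expR.
  by rewrite pmulr_lle0 ?invr_gt0// pmulr_rle0//; lra.
- by apply/sector1_angles; rewrite subrK mulNr divfK// opprK.
- rewrite phiE stripexp_polar//; congr (_ * _).
  by rewrite -[LHS](circlePtD_int _ (- eps s (n + 1))) mulrNz.
Qed.

Lemma psi_phi n z : W R s (n + 1) z -> psi (theta R s n) (phi R s n z) = phi R s (n + 1) z.
Proof.
have l0 := len_gt0 R s n; have l1 := len_gt0 R s (n - 1); have l2 := len_lt_half R s n.
have l3 := len_gt0 R s (n + 1); have := len_lt_half R s (n + 1); rewrite addrK => l4.
move=> [z0]; rewrite J_E /= /Jleft addrK => zJ.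
rewrite phiE psi_stripexp ?theta_neq0//; first by rewrite -len_rec phiE addrK.
by move: zJ; case: (epsRP R s (n + 1 + 1)) => -> /andP[? ?]; apply/andP; split; lra.
Qed.

Lemma W_strictly_nested n (m : nat) z : W R s (n + 1 + m%:Z) z ->
  Im z <= 0 /\ Jleft R s n < Re z < Jleft R s n + l (n - 1).
Proof. by move=> [z0 /J_strictly_nested]. Qed.

Lemma W_subset n (m : nat) : W R s (n + m%:Z) `<=` W R s n.
Proof.
case: m => [|m]; first by rewrite addr0.
rewrite -add1n PoszD addrA => z /W_strictly_nested[z0 /andP[z1 z2]].
by split=> //; rewrite J_E /= !ltW.
Qed.

(** A point w of the first sector is phi_n z with z in W_(n+1), and its image under
    psi is phi_(n+1) z.  If this is also phi_(n+1) z' with z' in a deeper W_k, then z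
    and z' differ by a multiple of l_n; as Re z' is in the open interval of length l_n
    whose closure contains Re z, they agree. *)
Lemma sectorS_phi (r : nat) n :
  sectorS R s r.+1 n `\ 0 = phi R s n @` W R s (n + 1 + r%:Z).
Proof.
elim: r n => [|r IH] n; first by rewrite addr0; exact: sector1_phi.
have WE : W R s (n + 1 + r.+1%:Z) = W R s (n + 1 + 1 + r%:Z).
  by congr (W R s); lia.
rewrite WE [sectorS _ _ _ _]/=; apply/seteqP; split=> w /=.
  move=> [[w1 w2] w0].
  have : (sector1 (theta R s n) `\ 0) w by [].
  rewrite sector1_phi => -[z zW zw].
  have pE : psi (theta R s n) w = phi R s (n + 1) z by rewrite -zw psi_phi.
  have : (sectorS R s r.+1 (n + 1) `\ 0) (psi (theta R s n) w).
    by split=> //=; apply/eqP; rewrite pE phiE stripexp_neq0.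
  rewrite IH pE => -[z' z'W /esym]; rewrite phiE addrK.
  move=> /stripexp_eq[|m zE]; first exact: len_gt0.
  have [z'0 z'J] := W_strictly_nested z'W.
  suff m0 : m = 0 by exists z' => //; rewrite -zw zE m0 mulr0 addr0.
  apply: (mul_int_small (len_gt0 R s n)).
  move: zW => [_]; rewrite zE Re_addR J_E /=; move: z'J; rewrite addrK => /andP[? ?] /andP[? ?].
  by apply/andP; split; lra.
move=> [z zW <-].
have zW1 : W R s (n + 1) z by move: zW; rewrite -addrA; apply: W_subset => //.
have : (sector1 (theta R s n) `\ 0) (phi R s n z) by rewrite sector1_phi; exists z.
move=> [w1 w0]; split=> //; split=> //.
rewrite psi_phi//.
by have [] : (sectorS R s r.+1 (n + 1) `\ 0) (phi R s (n + 1) z) by rewrite IH; exists z.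
Qed.

End Disk.

(** * Renormalization of the pair of times *)

Section Renormalization.
Variable s : int -> Sigma.
Implicit Types (n k : int) (j : bool).

(** The multiplicity of the first map of level k in the j-th map of level k + 1; the
    second map of level k occurs once. *)
Definition turns k j : int := bcoef s (k + 1) - 1 - (eps s (k + 1) * eps s (k + 1 + 1) *+ j).

Lemma turns_gt0 k j : 0 < turns k j.
Proof.
rewrite /turns /bcoef; have := abar_ge2 s (k + 1).
case: (epsP s (k + 1)) => ->; case: (epsP s (k + 1 + 1)) => ->; case: j;
  rewrite ?mulr0n ?mulr1n; set z := (_ %/ 2)%Z;
  (have -> : z = 0 by []) || (have -> : z = 1 by []); lia.
Qed.

Lemma retTime_succ k j :
  retTime s (k + 1) j = retTime s k false *~ turns k j + retTime s k true.
Proof.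
rewrite /retTime Q_rel addrK mulr0n mulr0z subr0 mulr1n /turns !mulrzBr mulr1z.
by rewrite -!addrA; congr (_ + _); rewrite addrCA [in RHS]addrCA addKr addrC.
Qed.

(** The step is the matrix with rows (q_0, 1) and (q_1, 1), where q_j is
    [turns k j]; its determinant q_0 - q_1 is -1 or 1, so it preserves the property of
    being a basis. *)
Lemma renormalization n (i : nat) : exists N M : bool -> int,
  [/\ forall j, 0 < N j,
      forall j, retTime s (n + i%:Z) j = Q s n *~ N j + Q s (n - 1) *~ M j
    & forall m p : int, exists c0 c1 : int,
        m = c0 * N false + c1 * N true /\ p = c0 * M false + c1 * M true].
Proof.
elim: i => [|i [N [M [N0 NM G]]]].
  exists (fun=> 1), (fun j => - (eps s n * eps s (n + 1) *+ j)); split=> // [j|m p].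
    by rewrite addr0 mulr1z mulrNz.
  exists (m + p * (eps s n * eps s (n + 1))), (- p * (eps s n * eps s (n + 1))).
  by case: (epsP s n) => ->; case: (epsP s (n + 1)) => ->; split; lia.
set k := n + i%:Z in NM.
have kE : n + i.+1%:Z = k + 1 by rewrite /k; lia.
exists (fun j => turns k j * N false + N true), (fun j => turns k j * M false + M true).
split=> [j|j|m p].
- by rewrite addr_gt0 ?mulr_gt0 ?turns_gt0.
- rewrite kE retTime_succ !NM.
  move: (turns k j) => t; rewrite !(mulrC t) mulrzDl !mulrzDr !mulrzA addrACA //.
have [c0 [c1 [-> ->]]] := G m p.
(* The inverse matrix of the renormalization step, applied to (c_0, c_1). *)
pose d := eps s (k + 1) * eps s (k + 1 + 1) * (c0 - c1 * turns k true).
exists d, (c1 - d).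
have tE : turns k false = turns k true + eps s (k + 1) * eps s (k + 1 + 1).
  by rewrite /turns mulr0n mulr1n; ring.
have dE : d * (eps s (k + 1) * eps s (k + 1 + 1)) = c0 - c1 * turns k true.
  by rewrite /d; case: (epsP s (k + 1)) => ->; case: (epsP s (k + 1 + 1)) => ->; ring.
rewrite tE; split.
  transitivity ((d * (eps s (k + 1) * eps s (k + 1 + 1)) + c1 * turns k true) * N false + c1 * N true).
    by rewrite dE; ring.
  by ring.
transitivity ((d * (eps s (k + 1) * eps s (k + 1 + 1)) + c1 * turns k true) * M false + c1 * M true).
  by rewrite dE; ring.
by ring.
Qed.

End Renormalization.

(** * First returns *)

Section FirstReturn.
Variables (R : realType) (s : int -> Sigma).
Local Notation e k := ((eps s k)%:~R : R).
Local Notation l k := (len R s k).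

(** After the reflection that makes eps (k + 1) equal to 1, a = l_k, b = l_(k-1), and the first map
    moves y by - a, the second one by b - a.  Nonzero coefficients of opposite signs move y
    by at least b, the length of the interval. *)
Lemma no_early_return (a b y : R) (j : bool) (N : bool -> int) (c0 c1 m : int) :
  0 < a -> a < b ->
  (if j then a - b < y < 2 * a - b else 2 * a - b < y < a) ->
  a - b <= y - c0%:~R * a + c1%:~R * (b - a) <= a ->
  (forall j, 0 < N j) -> 0 < m < N j -> m = c0 * N false + c1 * N true -> False.
Proof.
move=> a0 ab yj /andP[h1 h2] N0 /andP[m0 mN] mE.
have le1 (c : int) : 0 < c -> 1 <= c%:~R :> R by move=> c0'; rewrite -[1]/(1%:~R) ler_int; lia.
have [y1 y2] : a - b < y /\ y < a by case: j yj {mN} => /andP[? ?]; split; lra.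
have Nt := N0 true; have Nf := N0 false.
have [c0n|c0p] := ltP c0 0.
  have c0n' : (1 : R) <= - c0%:~R by rewrite -mulrNz; apply: le1; lia.
  have c1p : 0 < c1 by nia.
  have := le1 _ c1p; nra.
have [c1n|c1p] := ltP c1 0.
  have c1n' : (1 : R) <= - c1%:~R by rewrite -mulrNz; apply: le1; lia.
  have c0p' : 0 < c0 by nia.
  have := le1 _ c0p'; nra.
case: j yj mN => /andP[y3 y4] mN.
  have c10 : c1 = 0 by nia.
  have c0p' : 0 < c0 by nia.
  by have := le1 _ c0p'; move: h1; rewrite c10; nra.
have c00 : c0 = 0 by nia.
have c1p' : 0 < c1 by nia.
by have := le1 _ c1p'; move: h2; rewrite c00; nra.
Qed.

(** A visit to the sector lifts, along phi_n, to an element of the lattice that maps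
    z into W_k. *)
Lemma phi_first_return n (i : nat) j (z : R[i]^o) :
  Wj' R s (n + 1 + i%:Z) j z -> (Jj' R s (n + 1 + i%:Z) j)° (Re z) ->
  first_return (rotation (theta R s n)) (sectorS R s i.+1 n)
    (phi R s n z) (phi R s n (F (retTime s (n + 1 + i%:Z) j) z)).
Proof.
set k := n + 1 + i%:Z => -[z0 _] /Jj'_interior zj.
have l1 := len_gt0 R s (n - 1).
have lk0 := len_gt0 R s k; have lk1 := len_lt_half R s k.
have lk1' : l k < l (k - 1) by lra.
have [N [M [N0 NM G]]] := renormalization s n i.+1.
have kE : n + i.+1%:Z = k by rewrite /k; lia.
rewrite {}kE in NM.
have inS z' : W R s k z' -> sectorS R s i.+1 n (phi R s n z').
  move=> z'W; have [] // : (sectorS R s i.+1 n `\ 0) (phi R s n z').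
  by rewrite sectorS_phi; exists z'.
have JE x : J R s k x <-> l k - l (k - 1) <= e (k + 1) * x <= l k.
  rewrite J_E /= /Jleft; case: (epsRP R s (k + 1)) => ->;
    by split=> /andP[? ?]; apply/andP; split; lra.
split.
  apply: inS; split=> //; apply/JE.
  by case: j zj => /andP[? ?]; apply/andP; split; lra.
have absN : (`|N j|%N : int) = N j by rewrite gez0_abs// ltW.
exists `|N j|%N; split.
- by rewrite -ltz_nat absN.
- by rewrite iter_rotation NM phi_F_lattice -absN -pmulrn.
- apply: inS; split; first by rewrite Im_FE.
  apply/JE; rewrite Re_FE transl_retTime.
  by case: j zj {absN}; case: (epsRP R s (k + 1)) => -> /= /andP[? ?]; apply/andP; split; lra.
move=> m; rewrite -!ltz_nat absN => mN; rewrite iter_rotation => mS.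
(* A period of phi_n is a multiple of Q_[n-1], up to sign. *)
have [p [z' z'W z'E]] : exists p : int,
    exists2 z', W R s k z' & z' = F (Q s n *~ m + Q s (n - 1) *~ p) z.
  have E0 := phi_F_lattice s n m 0 z.
  have : (sectorS R s i.+1 n `\ 0) (rotation (m%:R * theta R s n) (phi R s n z)).
    split=> //=; apply/eqP.
    by rewrite pmulrn -(phi_F_lattice s n m 0 z) phiE stripexp_neq0.
  rewrite sectorS_phi => -[z' z'W]; rewrite pmulrn -(phi_F_lattice s n m 0 z) phiE.
  move=> /stripexp_eq[]// q z'E; exists (- (eps s n * q)); exists z' => //.
  rewrite z'E /F -addrA -rmorphD /=; congr (_ + _%:C).
  rewrite !raddfD !raddfMz /= !transl_Q subrK mulr0z addr0; congr (_ + _).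
  rewrite -[_ *~ - _]mulrzl mulrNz rmorphM /=.
  by case: (epsRP R s n) => ->; ring.
have [c0 [c1 [mE pE]]] := G m p.
apply: (@no_early_return (l k) (l (k - 1)) (e (k + 1) * Re z) j N c0 c1 m) => //.
have PE : Q s n *~ m + Q s (n - 1) *~ p =
    retTime s k false *~ c0 + retTime s k true *~ c1.
  by rewrite !NM mE pE !(mulrC c0) !(mulrC c1) !mulrzDr !mulrzDl !mulrzA addrACA.
move: z'W => [_ /JE]; rewrite z'E PE Re_FE raddfD !raddfMz /= !transl_retTime.
rewrite -[_ *~ c0]mulrzl -[_ *~ c1]mulrzl.
by case: (epsRP R s (k + 1)) => -> /= /andP[? ?]; apply/andP; split; lra.
Qed.

End FirstReturn.

Theorem proposition5p10 (R : realType) (s : int -> Sigma) (n : int) :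
  [/\ (forall z : R[i]^o, W R s n z -> closedDisk R (phi R s n z)),
      (* (1) *)
      conformal_onto (phi R s n) (W R s n)° (openDisk R `\` slit R s n) /\
      (forall j : bool,
         phi R s n @` verticalSide R s n j = slit R s n `\ 0),
      (* (2) *)
      (forall (j : bool) (z : R[i]^o), Wj' R s n j z ->
         phi R s n (F (retTime s n j) z) = rotation (theta R s n) (phi R s n z))
    & (* (3) *)
      (forall k : int, n + 1 <= k ->
         let S := sectorS R s (absz (k - n)) n in
         [/\ W R s k `<=` W R s n,
             conformal_onto (phi R s n) (W R s k) (S `\ 0)
           & forall (j : bool) (z : R[i]^o), Wj' R s k j z -> (Jj' R s k j)° (complex.Re z) ->
               first_return (rotation (theta R s n)) S
                 (phi R s n z) (phi R s n (F (retTime s k j) z))])].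
Proof.
have l1 := len_gt0 R s (n - 1).
split.
- by move=> z [z0 _]; rewrite /closedDisk /= phiE stripexp_norm_le1.
- split=> [|j]; last exact: phi_slit.
  rewrite -phi_interior_image phiE; apply: (@stripexp_conformal _ _ (Jleft R s n)) => // z.
  by rewrite W_interior => -[_]; exact.
- by move=> j z _; rewrite retTime_lattice phi_F_lattice mul1r.
move=> k kn; have [i kE] : exists i : nat, k = n + 1 + i%:Z.
  by exists (absz (k - (n + 1))%R); rewrite gez0_abs; lia.
have -> : absz (k - n) = i.+1 by rewrite kE; lia.
rewrite kE => S; split.
- by rewrite -addrA; apply: W_subset.
- rewrite /S sectorS_phi phiE; apply: (@stripexp_conformal _ _ (Jleft R s n)) => // z /W_strictly_nested[_]; exact.
- by move=> j z; exact: phi_first_return.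
Qed.
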